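(* Let $n,q\in\{1,2,\ldots\}$, let $\|\cdot\|$ be a norm on $\mathbb{R}^q$, let $C\subseteq\mathbb{R}^q$ be a closed convex cone that is solid, pointed and nontrivial, let $X\subseteq\mathbb{R}^n$ be convex, let $\Gamma\colon X\to\mathbb{R}^q$ be $C$-convex and continuous, and let $\mathcal{X}\subseteq X$ be a compact convex set with nonempty interior. Let $\mathcal{P}=\operatorname{cl}(\Gamma(\mathcal{X})+C)$. Let $v\in\mathbb{R}^q$, let $(x^v,z^v)$ be an arbitrary optimal solution of $(\mathrm{P}(v))$ and let $w^v$ be an arbitrary optimal solution of $(\mathrm{D}(v))$. Suppose that $w^v\neq 0$. Then the halfspace $$\mathcal{H}=\{y\in\mathbb{R}^q\mid (w^v)^{\mathsf T}y\geq (w^v)^{\mathsf T}\Gamma(x^v)\}$$ contains $\mathcal{P}$. Moreover, the boundary $\operatorname{bd}\mathcal{H}$ is a supporting hyperplane of $\mathcal{P}$ both at $\Gamma(x^v)$ and at $y^v:=v+z^v$. In particular, $(w^v)^{\mathsf T}\Gamma(x^v)=(w^v)^{\mathsf T}y^v$.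
   Context: A cone $C$ is solid if its interior is nonempty, pointed if it contains no line, nontrivial if $\{0\}\subsetneq C\subsetneq\mathbb{R}^q$. For $y_1,y_2\in\mathbb{R}^q$, $y_1\leq_C y_2$ means $y_2-y_1\in C$. $\Gamma$ is $C$-convex if $\Gamma(\lambda x_1+(1-\lambda)x_2)\leq_C\lambda\Gamma(x_1)+(1-\lambda)\Gamma(x_2)$ for all $x_1,x_2\in X$, $\lambda\in[0,1]$. The dual cone is $C^+=\{w\in\mathbb{R}^q\mid w^{\mathsf T}y\ge 0\ \forall y\in C\}$; $\|\cdot\|_*$ is the dual norm of $\|\cdot\|$. $(\mathrm{P}(v))$: minimize $\|z\|$ subject to $\Gamma(x)-z-v\leq_C 0$, $x\in\mathcal{X}$, $z\in\mathbb{R}^q$. $(\mathrm{D}(v))$ (its Lagrangian dual): maximize $\inf_{x\in\mathcal{X}}w^{\mathsf T}\Gamma(x)-w^{\mathsf T}v$ subject to $\|w\|_*\leq 1$, $w\in C^+$. Under the stated assumptions both problems have optimal solutions. For a convex set $A$, $y\in A$ and $w\in\mathbb{R}^q\setminus\{0\}$ with $w^{\mathsf T}y=\inf_{z\in A}w^{\mathsf T}z$, the set $\{z\mid w^{\mathsf T}z=w^{\mathsf T}y\}$ is called a supporting hyperplane of $A$ at $y$. *)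

(* Defs.v *)
From HB Require Import structures.
From mathcomp Require Import all_boot all_order all_algebra.
From mathcomp Require Import all_classical all_reals all_analysis.

Set Implicit Arguments.
Unset Strict Implicit.
Unset Printing Implicit Defensive.

Import Order.TTheory GRing.Theory Num.Theory.
Import numFieldNormedType.Exports.

Local Open Scope classical_set_scope.
Local Open Scope ring_scope.

(* R^k is 'rV[R]_k with its canonical (max-norm, hence Euclidean) topology. *)

Definition dot (R : realType) (k : nat) (w y : 'rV[R]_k) : R :=
  \sum_(i < k) w 0 i * y 0 i.

Record is_norm (R : realType) (k : nat) (N : 'rV[R]_k -> R) : Prop := IsNorm {
  is_norm_ge0 : forall x, 0 <= N x;
  is_norm_eq0 : forall x, N x = 0 -> x = 0;
  is_normZ : forall (a : R) x, N (a *: x) = `|a| * N x;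
  is_norm_triangle : forall x y, N (x + y) <= N x + N y
}.

(* The supremum is taken in the extended reals, so that it needs no
   boundedness proof; it is finite whenever N is a norm. *)
Definition dual_norm (R : realType) (k : nat) (N : 'rV[R]_k -> R)
    (w : 'rV[R]_k) : \bar R :=
  ereal_sup [set (dot w y)%:E | y in [set y | N y <= 1]].

Definition boundary (T : topologicalType) (A : set T) : set T :=
  closure A `\` A°.

Definition cone (R : realType) (k : nat) (C : set 'rV[R]_k) : Prop :=
  forall (a : R) y, 0 <= a -> C y -> C (a *: y).

Definition solid (R : realType) (k : nat) (C : set 'rV[R]_k) : Prop :=
  C° !=set0.

Definition pointed (R : realType) (k : nat) (C : set 'rV[R]_k) : Prop :=
  ~ exists a d : 'rV[R]_k, d != 0 /\ [set a + t *: d | t in [set: R]] `<=` C.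

Definition nontrivial (R : realType) (k : nat) (C : set 'rV[R]_k) : Prop :=
  [set 0] `<` C /\ C `<` [set: 'rV[R]_k].

Definition cone_le (R : realType) (k : nat) (C : set 'rV[R]_k)
    (y1 y2 : 'rV[R]_k) : Prop := C (y2 - y1).

Definition dual_cone (R : realType) (k : nat) (C : set 'rV[R]_k) :
    set 'rV[R]_k := [set w | forall y, C y -> 0 <= dot w y].

(* Functions X -> R^q are total functions of which only the values on X
   matter. *)
Definition cone_convex (R : realType) (n q : nat) (C : set 'rV[R]_q)
    (X : set 'rV[R]_n) (Gamma : 'rV[R]_n -> 'rV[R]_q) : Prop :=
  forall (x1 x2 : 'rV[R]_n) (l : R), X x1 -> X x2 -> 0 <= l <= 1 ->
    cone_le C (Gamma (l *: x1 + (1 - l) *: x2))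
              (l *: Gamma x1 + (1 - l) *: Gamma x2).

Definition upper_image (R : realType) (n q : nat) (C : set 'rV[R]_q)
    (Xf : set 'rV[R]_n) (Gamma : 'rV[R]_n -> 'rV[R]_q) : set 'rV[R]_q :=
  closure [set y + c | y in Gamma @` Xf & c in C].

Definition primal_feasible (R : realType) (n q : nat) (C : set 'rV[R]_q)
    (Xf : set 'rV[R]_n) (Gamma : 'rV[R]_n -> 'rV[R]_q) (v : 'rV[R]_q) :
    set ('rV[R]_n * 'rV[R]_q) :=
  [set xz | cone_le C (Gamma xz.1 - xz.2 - v) 0 /\ Xf xz.1].

Definition primal_optimal (R : realType) (n q : nat) (N : 'rV[R]_q -> R)
    (C : set 'rV[R]_q) (Xf : set 'rV[R]_n) (Gamma : 'rV[R]_n -> 'rV[R]_q)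
    (v : 'rV[R]_q) (xz : 'rV[R]_n * 'rV[R]_q) : Prop :=
  primal_feasible C Xf Gamma v xz /\
  forall xz', primal_feasible C Xf Gamma v xz' -> N xz.2 <= N xz'.2.

Definition dual_feasible (R : realType) (q : nat) (N : 'rV[R]_q -> R)
    (C : set 'rV[R]_q) : set 'rV[R]_q :=
  [set w | (dual_norm N w <= 1)%E /\ dual_cone C w].

Definition dual_objective (R : realType) (n q : nat) (Xf : set 'rV[R]_n)
    (Gamma : 'rV[R]_n -> 'rV[R]_q) (v w : 'rV[R]_q) : \bar R :=
  (ereal_inf [set (dot w (Gamma x))%:E | x in Xf] - (dot w v)%:E)%E.

Definition dual_optimal (R : realType) (n q : nat) (N : 'rV[R]_q -> R)
    (C : set 'rV[R]_q) (Xf : set 'rV[R]_n) (Gamma : 'rV[R]_n -> 'rV[R]_q)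
    (v w : 'rV[R]_q) : Prop :=
  dual_feasible N C w /\
  forall w', dual_feasible N C w' ->
    (dual_objective Xf Gamma v w' <= dual_objective Xf Gamma v w)%E.

Definition supporting_hyperplane (R : realType) (k : nat) (A : set 'rV[R]_k)
    (y : 'rV[R]_k) (S : set 'rV[R]_k) : Prop :=
  [/\ convex_set A, A y &
    exists w : 'rV[R]_k,
      [/\ w != 0, (dot w y)%:E = ereal_inf [set (dot w z)%:E | z in A] &
          S = [set z | dot w z = dot w y]]].

(* Main.v *)
Require Import Defs.
From HB Require Import structures.
From mathcomp Require Import all_boot all_order all_algebra.
From mathcomp Require Import all_classical all_reals all_analysis.
From mathcomp Require Import lra.

Set Implicit Arguments.
Unset Strict Implicit.
Unset Printing Implicit Defensive.

Import Order.TTheory GRing.Theory Num.Theory.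
Import numFieldNormedType.Exports.

Local Open Scope classical_set_scope.
Local Open Scope ring_scope.

(** The heart of the matter is strong duality: the optimal value of the dual is
    at least the optimal value [N zv] of the primal.  Granting this, a dual
    solution [wv] satisfies, for every [x] in [Xf],
<<
      N zv <= wv . Gamma x - wv . v,
>>
    whereas weak duality bounds the right-hand side at [x = xv]: since
    [v + zv - Gamma xv] lies in [C] and [wv] in the dual cone,
<<
      wv . Gamma xv - wv . v <= wv . zv <= N zv,
>>
    the last step being the dual norm bound on [wv].  All these numbers are
    therefore equal, so [wv . Gamma xv = wv . (v + zv)] and [xv] minimizes
    [wv . Gamma] over [Xf] ([complementary_slackness]).  As [wv] is nonnegative
    on [C], the halfspace contains [Gamma @` Xf + C], hence its closure [P];
    both [Gamma xv] and [v + zv] lie in [P] and on the boundary hyperplane,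
    which consequently supports [P] at these two points.

    Strong duality comes from separating convex sets.  The vectors [z] such
    that some [(x, z)] is feasible form the convex set
    [A = Gamma @` Xf + C - v], on which [N] is at least [N zv].  If
    [r < N zv], then [A] is at positive distance from the closed [N]-ball of
    radius [r], and the two are separated by some [w] which, once rescaled, has
    dual norm at most 1 and is at least [r] on [A] ([norm_separation]).  Being
    bounded below on a translate of the cone [C], this [w] is in the dual
    cone.  It is thus feasible for the dual, with value at least [r]
    ([approximate_dual_solution]), and the value of [wv] is at least [r] for
    every [r < N zv].  Working with [r < N zv] rather than with [r = N zv]
    makes strict separation available, so that separation reduces to the
    existence of a shortest vector in a closed convex set
    ([separate_origin]). *)

(** * The inner product *)

Section InnerProduct.
Context {R : realType} {k : nat}.
Implicit Types (w x y : 'rV[R]_k) (a : R).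

Lemma dotC w y : dot w y = dot y w.
Proof. by apply: eq_bigr => i _; rewrite mulrC. Qed.

Lemma dotDr w x y : dot w (x + y) = dot w x + dot w y.
Proof. by rewrite -big_split; apply: eq_bigr => i _; rewrite !mxE mulrDr. Qed.

Lemma dotZr a w y : dot w (a *: y) = a * dot w y.
Proof. by rewrite mulr_sumr; apply: eq_bigr => i _; rewrite !mxE mulrCA. Qed.

Lemma dotNr w y : dot w (- y) = - dot w y.
Proof. by rewrite -scaleN1r dotZr mulN1r. Qed.

Lemma dotBr w x y : dot w (x - y) = dot w x - dot w y.
Proof. by rewrite dotDr dotNr. Qed.

Lemma dotDl w x y : dot (x + y) w = dot x w + dot y w.
Proof. by rewrite dotC dotDr !(dotC w). Qed.

Lemma dotZl a w y : dot (a *: w) y = a * dot w y.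
Proof. by rewrite dotC dotZr dotC. Qed.

Lemma dot0l y : dot 0 y = 0.
Proof. by rewrite -(scale0r 0) dotZl mul0r. Qed.

Lemma dot_sqr_coord y i : (y 0 i) ^+ 2 <= dot y y.
Proof.
rewrite /dot (bigD1 i)//= expr2 lerDl sumr_ge0// => j _.
by rewrite -expr2 sqr_ge0.
Qed.

Lemma dot_ge0 y : 0 <= dot y y.
Proof. by apply: sumr_ge0 => i _; rewrite -expr2 sqr_ge0. Qed.

Lemma dot_gt0 y : y != 0 -> 0 < dot y y.
Proof.
move=> y0; rewrite lt_neqAle dot_ge0 andbT eq_sym.
apply: contra y0 => /eqP yy0; apply/eqP/rowP => i; rewrite mxE.
have := dot_sqr_coord y i; rewrite yy0 => h.
by apply/eqP; rewrite -sqrf_eq0 eq_le h sqr_ge0.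
Qed.

Lemma dot_continuous (T : topologicalType) (f g : T -> 'rV[R]_k) :
  continuous f -> continuous g -> continuous (fun t => dot (f t) (g t)).
Proof.
move=> cf cg; apply: continuous_big => [|i _ t]; first exact: add_continuous.
have coord_cont (h : T -> 'rV[R]_k) : continuous h -> {for t, continuous (fun t => h t 0 i)}.
  move=> ch; apply: (@continuous_comp _ _ _ h (fun M : 'rV[R]_k => M 0 i)).
    exact: ch.
  exact: coord_continuous.
by apply: cvgM; exact: coord_cont.
Qed.

Lemma dotr_continuous w : continuous (dot w).
Proof.
apply: (@dot_continuous _ (cst w) id); first exact: cst_continuous.
by move=> x; exact: cvg_id.
Qed.

End InnerProduct.

(** * Convex sets and their closures *)

Section Convexity.
Context {R : realType} {V : normedModType R}.
Implicit Types A : set V.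

Lemma convex_setP A :
  convex_set A <-> forall x y (l : R), A x -> A y -> 0 <= l <= 1 ->
    A (l *: x + (1 - l) *: y).
Proof.
split=> [cA x y l Ax Ay /andP[l0 l1]|cA x y l].
  have := cA x y (Itv01 l0 l1); rewrite !inE /conv/= => /(_ Ax Ay).
  exact.
rewrite !inE => Ax Ay; apply: (cA x y l%:num Ax Ay).
by apply/andP; split.
Qed.

(** A continuous map sending [B] into [closure A] sends [closure B] there too;
    this is applied to an affine combination, one argument at a time. *)
Lemma convex_closure A : convex_set A -> convex_set (closure A).
Proof.
move=> /convex_setP cA; apply/convex_setP => x y l clx cly l01.
have slice (f : V -> V) B : continuous f -> B `<=` f @^-1` closure A ->
    closure B `<=` f @^-1` closure A.
  move=> cf; rewrite [closure B]closureE => BA; apply: smallest_sub => //.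
  by apply: preimage_closed => [z _|]; [exact: cf|exact: closed_closure].
have affine_continuous a (b : V) : continuous (fun z => a *: z + b).
  by move=> z; apply: cvgD; [apply: cvgZl_tmp; exact: cvg_id|exact: cvg_cst].
have clAx (y' : V) : A y' -> closure A (l *: x + (1 - l) *: y').
  move=> Ay'; apply: (slice (fun z => l *: z + (1 - l) *: y') A) => //.
  by move=> z Az /=; apply: subset_closure; exact: cA.
rewrite addrC; apply: (slice (fun z => (1 - l) *: z + l *: x) A) => //.
by move=> z Az /=; rewrite addrC; exact: clAx.
Qed.

End Convexity.

(** * Separation of a convex set from the origin *)

Section Separation.
Context {R : realType} {k : nat}.
Implicit Types (w x y d : 'rV[R]_k) (D : set 'rV[R]_k).

(** Only the part of [D] no longer than a given vector of [D] matters, and it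
    is compact. *)
Lemma shortest_vector D : D !=set0 -> closed D ->
  exists2 d, D d & forall y, D y -> dot d d <= dot y y.
Proof.
move=> [d0 Dd0] clD.
pose K := D `&` [set y | dot y y <= dot d0 d0].
have sq_cont : continuous (fun y => dot y y).
  by apply: (@dot_continuous _ _ _ id id) => x; exact: cvg_id.
have clK : closed K.
  apply: closedI => //.
  apply: (@preimage_closed _ _ (fun y => dot y y) [set r | r <= dot d0 d0]).
    by move=> y _; exact: sq_cont.
  exact: closed_le.
have bK : bounded_set K.
  exists (dot d0 d0 + 1); split; first exact: num_real.
  move=> M ltM y [_ /= ley]; apply: ltW; apply: le_lt_trans ltM.
  rewrite [leLHS]/Num.norm/= mx_normrE; apply/bigmax_leP; split.
    by rewrite addr_ge0// dot_ge0.
  move=> [i j] _; rewrite (ord1 i)/=.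
  have := le_trans (dot_sqr_coord y j) ley.
  (* with [t] the modulus of a coordinate, t <= t ^+ 2 + 1 *)
  rewrite -real_normK ?num_real//; set t := `|_|; nra.
have [d] := EVT_min_rV (ex_intro _ d0 (conj Dd0 (lexx _)))
  (bounded_closed_compact bK clK) (continuous_subspaceT sq_cont).
rewrite inE => -[Dd led] mind; exists d => // y Dy.
have [ley|/ltW ltd] := leP (dot y y) (dot d0 d0).
  by apply: mind; rewrite inE.
exact: le_trans led ltd.
Qed.

(** First-order optimality: if [dot d y < dot d d], then a small step from [d]
    towards [y] stays in [D] and shortens [d]. *)
Lemma shortest_vector_obtuse D d : convex_set D -> D d ->
  (forall y, D y -> dot d d <= dot y y) ->
  forall y, D y -> dot d d <= dot d y.
Proof.
move=> /convex_setP cD Dd mind y Dy; rewrite leNgt; apply/negP => lt_dy.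
pose s := dot d d - dot d y; pose m := dot (y - d) (y - d).
have s0 : 0 < s by rewrite subr_gt0.
have m0 : 0 <= m by exact: dot_ge0.
(* The squared length of [d + t *: (y - d)] is [dot d d - 2 * t * s + t ^+ 2 * m],
   least at [t = s / m]; adding [s] to the denominator keeps [t] below 1 and
   covers [m = 0]. *)
pose t := s / (m + s).
have ms0 : 0 < m + s by rewrite ltr_wpDl.
have t01 : 0 <= t <= 1.
  by rewrite divr_ge0 ?(ltW s0) ?(ltW ms0)//= ler_pdivrMr// mul1r lerDr.
have := mind _ (cD _ _ _ Dy Dd t01).
have -> : t *: y + (1 - t) *: d = d + t *: (y - d).
  by rewrite scalerBl scale1r scalerBr addrCA.
rewrite dotDl !dotDr !dotZl !dotZr -/m (dotC (y - d) d) dotBr.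
have -> : dot d y - dot d d = - s by rewrite opprB.
have : t * (m + s) = s by rewrite divfK// gt_eqF.
have : 0 < t by rewrite divr_gt0.
nra.
Qed.

Lemma separate_origin D : D !=set0 -> convex_set D -> ~ closure D 0 ->
  exists w, exists2 e, 0 < e & forall y, D y -> e <= dot w y.
Proof.
move=> D0 cD clD0.
have [d cld mind] := shortest_vector (subset_nonempty (@subset_closure _ D) D0)
  (@closed_closure _ D).
exists d, (dot d d); last first.
  move=> y Dy; apply: (shortest_vector_obtuse (convex_closure cD) cld mind).
  exact: subset_closure.
apply: dot_gt0; apply: contra_notN clD0 => /eqP d0.
by rewrite -d0.
Qed.

End Separation.

(** * Dual norms and separation from a ball *)

Section Norm.
Context {R : realType} {k : nat} (N : 'rV[R]_k -> R) (N_norm : is_norm N).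

Lemma is_norm0 : N 0 = 0.
Proof. by rewrite -(scale0r 0) (is_normZ N_norm) normr0 mul0r. Qed.

Lemma coord_le_norm (y : 'rV[R]_k) i : `|y 0 i| <= `|y|.
Proof.
rewrite [leRHS]/Num.norm/= mx_normrE.
exact: (le_bigmax _ (fun ij => `|y ij.1 ij.2|) (0, i)).
Qed.

Lemma is_norm_bounded : exists2 K, 0 < K & forall y, N y <= K * `|y|.
Proof.
exists (1 + \sum_(i < k) N 'e_i).
  by rewrite ltr_pwDl// sumr_ge0// => i _; exact: (is_norm_ge0 N_norm).
move=> y; rewrite mulrDl mul1r mulr_suml; apply: ler_wpDl => //.
rewrite {1}(row_sum_delta y).
elim/big_ind2 : _ => [|x1 a1 x2 a2 le1 le2|i _].
- by rewrite is_norm0.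
- by apply: le_trans (is_norm_triangle N_norm _ _) _; exact: lerD.
- rewrite (is_normZ N_norm) mulrC ler_wpM2l ?coord_le_norm//.
  exact: (is_norm_ge0 N_norm).
Qed.

Lemma dual_norm_le1P w : (dual_norm N w <= 1)%E <-> forall y, dot w y <= N y.
Proof.
split=> [lew y|lew].
  have [y0|y0] := eqVneq y 0.
    by rewrite y0 is_norm0 dotC dot0l.
  have Ny : 0 < N y.
    rewrite lt_neqAle (is_norm_ge0 N_norm) andbT eq_sym.
    by apply: contra y0 => /eqP /(is_norm_eq0 N_norm)/eqP.
  have : ((dot w ((N y)^-1 *: y))%:E <= 1)%E.
    apply: le_trans lew; apply: ereal_sup_ubound; exists ((N y)^-1 *: y) => //=.
    by rewrite (is_normZ N_norm) gtr0_norm ?invr_gt0// mulVf// gt_eqF.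
  by rewrite lee_fin dotZr mulrC ler_pdivrMr// mul1r.
apply: ge_ereal_sup => _ [y /= y1 <-].
by rewrite lee_fin; exact: le_trans (lew y) y1.
Qed.

(** Separating [0] from the differences [a - b], with [N b <= r'], gives [w] with
    [e + dot w b <= dot w a].  Multiplied by [r' / m], where [m] is the infimum
    of [w] over [A], it is at least [r'] on [A]; and it is at most 1 on the unit
    ball because [r' * dot w y = dot w (r' *: y) <= m].  The gap [e > 0] makes
    [m] positive. *)
Lemma norm_separation (A : set 'rV[R]_k) r r' :
  A !=set0 -> convex_set A -> 0 <= r' < r -> (forall a, A a -> r <= N a) ->
  exists w, (dual_norm N w <= 1)%E /\ forall a, A a -> r' <= dot w a.
Proof.
move=> [a0 Aa0] /convex_setP cA /andP[r'0 r'r] rA.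
pose D := [set a - b | a in A & b in [set b | N b <= r']].
have D0 : D !=set0 by exists (a0 - 0), a0 => //; exists 0; rewrite //= is_norm0.
have cD : convex_set D.
  apply/convex_setP => _ _ l [a1 Aa1 [b1 /= Nb1 <-]] [a2 Aa2 [b2 /= Nb2 <-]] l01.
  exists (l *: a1 + (1 - l) *: a2); first exact: cA.
  exists (l *: b1 + (1 - l) *: b2) => /=.
    apply: le_trans (is_norm_triangle N_norm _ _) _.
    rewrite !(is_normZ N_norm) !ger0_norm; try lra.
    nra.
  by rewrite !scalerBr opprD addrACA.
(* [N] is at least [r - r'] on [D], and small near the origin. *)
have clD : ~ closure D 0.
  have [K K0 NK] := is_norm_bounded.
  move=> /(_ _ (nbhsx_ballx 0 ((r - r') / K) _))[].
    by rewrite divr_gt0// subr_gt0.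
  move=> _ [[a Aa [b /= Nb <-]]]; rewrite -ball_normE/= sub0r normrN.
  rewrite ltr_pdivlMr// mulrC => /(le_lt_trans (NK _)).
  have := is_norm_triangle N_norm (a - b) b; rewrite subrK.
  have := rA _ Aa; lra.
have [w [e e0 we]] := separate_origin D0 cD clD.
have wA a b : A a -> N b <= r' -> e + dot w b <= dot w a.
  by move=> Aa Nb; rewrite -lerBrDr -dotBr; apply: we; exists a => //; exists b.
pose S := [set dot w a | a in A].
have S0 : S !=set0 by exists (dot w a0), a0.
have lbS b : N b <= r' -> lbound S (e + dot w b).
  by move=> Nb _ [a Aa <-]; exact: wA.
have m_ge b : N b <= r' -> e + dot w b <= inf S.
  by move=> Nb; apply: lb_le_inf => //; exact: lbS.
have m0 : 0 < inf S.
  by have := m_ge 0; rewrite is_norm0 dotC dot0l addr0 => /(_ r'0); lra.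
have ge_m a : A a -> inf S <= dot w a.
  move=> Aa; apply: ge_inf; last by exists a.
  by exists (e + dot w 0); apply: lbS; rewrite is_norm0.
exists ((r' / inf S) *: w); split; last first.
  move=> a Aa; rewrite dotZl mulrAC ler_pdivlMr//.
  by rewrite ler_wpM2l//; exact: ge_m.
apply: ge_ereal_sup => _ [y /= y1 <-].
rewrite lee_fin dotZl mulrAC ler_pdivrMr// mul1r -dotZr.
have : N (r' *: y) <= r' by rewrite (is_normZ N_norm) ger0_norm// ler_piMr.
by move=> /m_ge; lra.
Qed.

End Norm.

(** * Halfspaces *)

Lemma closed_halfspace (R : realType) (k : nat) (w : 'rV[R]_k) (a : R) :
  closed [set y | a <= dot w y].
Proof.
apply: (@preimage_closed _ _ (dot w) [set r | a <= r]); last exact: closed_ge.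
by move=> y _; exact: dotr_continuous.
Qed.

(** A point with [dot w y = a] is not interior: moving it along [- w], however
    little, leaves the halfspace. *)
Lemma boundary_halfspace (R : realType) (k : nat) (w : 'rV[R]_k) (a : R) :
  w != 0 -> boundary [set y | a <= dot w y] = [set y | dot w y = a].
Proof.
move=> w0; pose H := [set y | a <= dot w y].
rewrite /boundary -(proj1 (closure_id H) (@closed_halfspace _ _ w a)); apply/seteqP; split => y /=.
  move=> [/= ay]; apply: contra_notP => /eqP ya.
  have {ya}ay' : a < dot w y by rewrite lt_neqAle eq_sym ya.
  have opG : open [set y | a < dot w y].
    apply: (@open_comp _ _ (dot w) [set r | a < r]); last exact: open_gt.
    by move=> z _; exact: dotr_continuous.
  have : [set y | a < dot w y] `<=` H by move=> z /= /ltW.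
  by rewrite (open_subsetE _ opG) => /(_ y ay').
move=> ya; split; first by rewrite /H/= ya.
move=> /nbhs_ballP[e /= e0 eH].
pose t := e / (2 * (1 + `|w|)).
have w1 : 0 < 1 + `|w| by rewrite ltr_pwDl.
have t0 : 0 < t by rewrite divr_gt0// mulr_gt0.
have /eH : ball y e (y - t *: w).
  rewrite -ball_normE/= opprB addrC subrK normrZ gtr0_norm//.
  have : t * (2 * (1 + `|w|)) = e by rewrite divfK// gt_eqF// mulr_gt0.
  have : 0 <= `|w| by [].
  nra.
rewrite /H/= dotBr dotZr ya.
have := mulr_gt0 t0 (dot_gt0 w0); lra.
Qed.

Lemma supporting_hyperplane_boundary (R : realType) (q : nat)
    (A : set 'rV[R]_q) (w y : 'rV[R]_q) (a : R) :
  w != 0 -> convex_set A -> A y -> dot w y = a ->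
  A `<=` [set z | a <= dot w z] ->
  supporting_hyperplane A y (boundary [set z | a <= dot w z]).
Proof.
move=> w0 cA Ay <- AH; split=> //; exists w; split=> //.
  apply/eqP; rewrite eq_le; apply/andP; split.
    by apply: le_ereal_inf_tmp => _ [z Az <-]; rewrite lee_fin; exact: AH.
  by apply: ereal_inf_lbound; exists y.
exact: boundary_halfspace.
Qed.

(** * The upper image *)

Section UpperImage.
Context {R : realType} {n q : nat}.
Variables (C : set 'rV[R]_q) (Xf : set 'rV[R]_n) (Gamma : 'rV[R]_n -> 'rV[R]_q).
Hypotheses (C_cone : cone C) (C_convex : convex_set C).

Lemma cone_addr y z : C y -> C z -> C (y + z).
Proof.
move=> Cy Cz.
have -> : y + z = 2 *: (2^-1 *: y + (1 - 2^-1) *: z).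
  have -> : 1 - 2^-1 = 2^-1 :> R by lra.
  by rewrite -scalerDr scalerA divff ?scale1r.
apply: C_cone => //; move/convex_setP: C_convex; apply => //.
by apply/andP; split; lra.
Qed.

Lemma mem_image_add_cone y :
  [set y + c | y in Gamma @` Xf & c in C] y <->
  exists2 x, Xf x & C (y - Gamma x).
Proof.
split=> [[_ [x Xx <-] [c Cc <-]]|[x Xx Cy]].
  by exists x; rewrite // addrC addKr.
exists (Gamma x); first by exists x.
by exists (y - Gamma x); rewrite // addrC subrK.
Qed.

(** [Gamma @` Xf] itself need not be convex: the cone absorbs the difference
    between the combination of the images and the image of the combination. *)
Lemma convex_image_add_cone : convex_set Xf -> cone_convex C Xf Gamma ->
  convex_set [set y + c | y in Gamma @` Xf & c in C].
Proof.
move=> /convex_setP Xf_convex Gamma_convex; apply/convex_setP => y1 y2 l.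
move=> /mem_image_add_cone[x1 Xx1 Cy1] /mem_image_add_cone[x2 Xx2 Cy2] l01.
apply/mem_image_add_cone; exists (l *: x1 + (1 - l) *: x2); first exact: Xf_convex.
have := cone_addr (proj1 (convex_setP C) C_convex _ _ _ Cy1 Cy2 l01)
  (Gamma_convex _ _ _ Xx1 Xx2 l01).
by rewrite !scalerBr [X in X + _]addrACA -opprD subrKA.
Qed.

End UpperImage.

(** * Strong duality and complementary slackness *)

Section Duality.
Context {R : realType} {n q : nat}.
Variables (N : 'rV[R]_q -> R) (C : set 'rV[R]_q).
Variables (Xf : set 'rV[R]_n) (Gamma : 'rV[R]_n -> 'rV[R]_q).
Hypotheses (N_norm : is_norm N) (C_cone : cone C) (C_convex : convex_set C).
Hypotheses (Xf_convex : convex_set Xf) (Gamma_convex : cone_convex C Xf Gamma).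

(** If [dot w c < 0], then [dot w (a + t *: c)] falls below any bound as [t]
    grows. *)
Lemma bounded_below_dual_cone (w a : 'rV[R]_q) (r : R) :
  (forall c, C c -> r <= dot w (a + c)) -> dual_cone C w.
Proof.
move=> bnd c Cc; rewrite leNgt; apply/negP => wc.
have C0 : C 0 by rewrite -(scale0r c); exact: C_cone.
(* the [t] for which [dot w (a + t *: c) = r - 1] *)
pose t := (dot w a - r + 1) / - dot w c.
have ra : r <= dot w a by have := bnd _ C0; rewrite addr0.
have t0 : 0 <= t by rewrite divr_ge0; lra.
have := bnd _ (C_cone t0 Cc).
have tE : t * - dot w c = dot w a - r + 1 by rewrite divfK//; lra.
by rewrite dotDr dotZr; lra.
Qed.

Lemma primal_feasibleE v x z :
  primal_feasible C Xf Gamma v (x, z) <-> Xf x /\ C (v + z - Gamma x).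
Proof.
rewrite /primal_feasible/cone_le/= sub0r.
have -> : - (Gamma x - z - v) = v + z - Gamma x.
  by rewrite !opprB addrA.
by split=> -[].
Qed.

(** The dual value comes arbitrarily close to the primal value.  For negative [r]
    there is no ball to separate from, but [w = 0] has dual value 0. *)
Lemma approximate_dual_solution v xv zv r :
  primal_optimal N C Xf Gamma v (xv, zv) -> r < N zv ->
  exists2 w, dual_feasible N C w &
    forall x, Xf x -> r <= dot w (Gamma x) - dot w v.
Proof.
move=> [/primal_feasibleE[Xxv Czv] opt] rN.
have [r0|r0] := ltP r 0.
  exists 0; last by move=> x _; rewrite !dot0l subr0 ltW.
  split; last by move=> c _; rewrite dot0l.
  by apply/(dual_norm_le1P N_norm) => y; rewrite dot0l (is_norm_ge0 N_norm).
pose G := [set y + c | y in Gamma @` Xf & c in C].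
pose A := [set z | G (v + z)].
have GP := mem_image_add_cone C Xf Gamma.
have cA : convex_set A.
  apply/convex_setP => z1 z2 l Gz1 Gz2 l01; rewrite /A/=.
  have -> : v + (l *: z1 + (1 - l) *: z2) = l *: (v + z1) + (1 - l) *: (v + z2).
    by rewrite !scalerDr addrACA -scalerDl subrKC scale1r.
  have /convex_setP := convex_image_add_cone C_cone C_convex Xf_convex Gamma_convex.
  exact.
have A0 : A !=set0 by exists zv; apply/GP; exists xv.
have NA z : A z -> N zv <= N z.
  by move=> /GP[x Xx Cz]; apply: (opt (x, z)); apply/primal_feasibleE.
have r01 : 0 <= r < N zv by rewrite r0.
have [w [w1 wA]] := norm_separation N_norm A0 cA r01 NA.
have wG x c : Xf x -> C c -> r <= dot w (Gamma x - v + c).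
  move=> Xx Cc; apply: wA; apply/GP; exists x => //.
  by rewrite addrA subrKC [_ + c]addrC addrK.
have C0 : C 0 by rewrite -(scale0r (v + zv - Gamma xv)); exact: C_cone.
exists w; last by move=> x Xx; have := wG x 0 Xx C0; rewrite addr0 dotBr.
by split=> //; apply: (bounded_below_dual_cone (fun c => wG xv c Xxv)).
Qed.

Lemma dual_optimal_norm_le v xv zv wv :
  primal_optimal N C Xf Gamma v (xv, zv) -> dual_optimal N C Xf Gamma v wv ->
  forall x, Xf x -> N zv <= dot wv (Gamma x) - dot wv v.
Proof.
move=> Pv [_ wv_opt] x Xx; apply/ler_addgt0Pr => e e0.
have rN : N zv - e < N zv by rewrite ltrBlDr ltrDl.
have [w wF wr] := approximate_dual_solution Pv rN.
rewrite -lerBlDr -lee_fin; apply: (@le_trans _ _ (dual_objective Xf Gamma v w)).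
  rewrite /dual_objective leeBrDr// -EFinD; apply: le_ereal_inf_tmp.
  by move=> _ [x' Xx' <-]; rewrite lee_fin -lerBrDr; exact: wr.
apply: le_trans (wv_opt _ wF) _.
rewrite /dual_objective EFinB leeB//.
by apply: ereal_inf_lbound; exists x.
Qed.

(** Strong and weak duality close the chain
    [N zv <= wv . Gamma xv - wv . v <= wv . zv <= N zv]. *)
Lemma complementary_slackness v xv zv wv :
  primal_optimal N C Xf Gamma v (xv, zv) -> dual_optimal N C Xf Gamma v wv ->
  dot wv (Gamma xv) = dot wv (v + zv) /\
  forall x, Xf x -> dot wv (Gamma xv) <= dot wv (Gamma x).
Proof.
move=> Pv Dv; have [[/primal_feasibleE[Xxv Czv] _] [[wv1 wvC] _]] := (Pv, Dv).
have wz : dot wv zv <= N zv by move/(dual_norm_le1P N_norm) : wv1; exact.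
have := wvC _ Czv; rewrite dotBr dotDr => wx.
have Nx := dual_optimal_norm_le Pv Dv.
split; first by apply/eqP; rewrite eq_le; have := Nx _ Xxv; lra.
by move=> x /Nx; lra.
Qed.

End Duality.

Theorem proposition4p7 (R : realType) (n q : nat)
    (n_gt0 : (0 < n)%N) (q_gt0 : (0 < q)%N)
    (N : 'rV[R]_q -> R) (N_norm : is_norm N)
    (C : set 'rV[R]_q) (C_closed : closed C) (C_convex : convex_set C)
    (C_cone : cone C) (C_solid : solid C) (C_pointed : pointed C)
    (C_nontrivial : nontrivial C)
    (X : set 'rV[R]_n) (X_convex : convex_set X)
    (Gamma : 'rV[R]_n -> 'rV[R]_q) (Gamma_convex : cone_convex C X Gamma)
    (Gamma_continuous : {within X, continuous Gamma})
    (Xf : set 'rV[R]_n) (Xf_sub : Xf `<=` X) (Xf_compact : compact Xf)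
    (Xf_convex : convex_set Xf) (Xf_interior : Xf° !=set0)
    (v : 'rV[R]_q) (xv : 'rV[R]_n) (zv wv : 'rV[R]_q)
    (xzv_optimal : primal_optimal N C Xf Gamma v (xv, zv))
    (wv_optimal : dual_optimal N C Xf Gamma v wv)
    (wv_neq0 : wv != 0) :
  let P := upper_image C Xf Gamma in
  let H := [set y | dot wv (Gamma xv) <= dot wv y] in
  let yv := v + zv in
  [/\ P `<=` H,
      supporting_hyperplane P (Gamma xv) (boundary H),
      supporting_hyperplane P yv (boundary H) &
      dot wv (Gamma xv) = dot wv yv].
Proof.
move=> P H yv.
have Gamma_convex' : cone_convex C Xf Gamma.
  by move=> x1 x2 l /Xf_sub Xx1 /Xf_sub; exact: Gamma_convex.
have [/primal_feasibleE[Xxv Czv] _] := xzv_optimal.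
have [wE wmin] := complementary_slackness N_norm C_cone C_convex Xf_convex
  Gamma_convex' xzv_optimal wv_optimal.
have [[_ wvC] _] := wv_optimal.
have clH : closed H by exact: closed_halfspace.
have C0 : C 0 by rewrite -(scale0r (v + zv - Gamma xv)); exact: C_cone.
have PH : P `<=` H.
  rewrite /P /upper_image closureE; apply: smallest_sub => //.
  move=> y /mem_image_add_cone[x Xx Cy]; rewrite /H/=.
  apply: le_trans (wmin _ Xx) _.
  by rewrite -subr_ge0 -dotBr; exact: wvC.
have cP : convex_set P.
  by apply: convex_closure; exact: convex_image_add_cone.
have memP y : C (y - Gamma xv) -> P y.
  by move=> Cy; apply/subset_closure/mem_image_add_cone; exists xv.
split=> //; apply: supporting_hyperplane_boundary => //; apply: memP => //.
by rewrite subrr.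
Qed.
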